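(* For every $k\ge 3$ and $c\ge 0.7\cdot 2^k$ there exists $\varepsilon>0$ such that the following holds. Let $F$ be drawn from $\mathcal{F}(k,n,cn)$, $L:=(1+\varepsilon)^n$, and let $\mathcal{F}^L_{\mathsf{sLB}}(F)$ be the CNF encoding that $F$ has no resolution refutation with at most $L$ clauses. With probability tending to $1$ as $n\to\infty$ over $F$, $\mathcal{F}^L_{\mathsf{sLB}}(F)$ admits a $\gamma$-random resolution refutation of width $\mathrm{poly}(n)$ with $\gamma=2^{-\Omega(n)}$.
   Context: $\mathcal{F}(k,n,m)$: random $k$-CNF over $n$ variables with $m$ clauses chosen independently and uniformly among the $\binom{n}{k}2^k$ ordinary width-$k$ clauses. $\mathcal{F}^L_{\mathsf{sLB}}(F)$: CNF whose variables encode in binary a purported resolution refutation $C_0,\dots,C_{L-1}$ of $F$ (each node: a clause over the $n$ variables, a tag resolution/weakening, indices of earlier predecessors, resolved variable; $O(n+\log L)$ bits per node), containing, for each possible invalid node, clauses (from the negation of the verifying decision tree) asserting that node is valid, and asserting the last clause is empty; it has width $O(n+\log L)$. An $\varepsilon$-random resolution refutation of an unsatisfiable CNF $H$ is a distribution $\mathcal{D}$ over pairs $(\Pi,B)$, where $B$ is a CNF over the variables of $H$, $\Pi$ is a resolution refutation of $H\wedge B$, and for every assignment $x$, $\Pr_{(\Pi,B)\sim\mathcal{D}}[B(x)=1]\ge 1-\varepsilon$. Its width is the maximum width of $\Pi$ in the support. *)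

(* Defs.v *)
From HB Require Import structures.
From mathcomp Require Import all_boot all_order all_algebra.
From mathcomp Require Import boolp reals exp.
Set Implicit Arguments. Unset Strict Implicit. Unset Printing Implicit Defensive.
Import Order.TTheory GRing.Theory Num.Theory.
Local Open Scope ring_scope.

Section Resolution.
Variable V : eqType.

Definition lit := (V * bool)%type.
Definition clause := seq lit.
Definition cnf := seq clause.

Definition lit_sat (x : V -> bool) (l : lit) : bool := x l.1 == l.2.
Definition clause_sat (x : V -> bool) (C : clause) : bool := has (lit_sat x) C.
Definition cnf_sat (x : V -> bool) (B : cnf) : bool := all (clause_sat x) B.

Definition cwidth (C : clause) : nat := size (undup C).
Definition pwidth (P : seq clause) : nat := \max_(C <- P) cwidth C.

Definition res_step (Ax : clause -> Prop) (prev : seq clause) (C : clause) : Prop :=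
  (exists A, Ax A /\ {subset A <= C})
  \/ (exists D, D \in prev /\ {subset D <= C})
  \/ (exists D1 D2 (v : V),
        [/\ D1 \in prev /\ D2 \in prev, (v, true) \in D1, (v, false) \in D2,
            (forall l, l \in D1 -> l != (v, true) -> l \in C) &
            (forall l, l \in D2 -> l != (v, false) -> l \in C)]).

Definition refutation (Ax : clause -> Prop) (P : seq clause) : Prop :=
  (forall i, (i < size P)%N -> res_step Ax (take i P) (nth [::] P i))
  /\ [::] \in P.

Definition var_of (H : clause -> Prop) (v : V) : Prop :=
  exists A, H A /\ v \in map fst A.

Definition random_refutation (R : realType) (H : clause -> Prop)
    (eps : R) (w : nat) : Prop :=
  exists D : seq (R * (seq clause * cnf)),
    [/\ (forall e, e \in D -> 0 <= e.1),
        \sum_(e <- D) e.1 = 1,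
        (forall e, e \in D -> 0 < e.1 ->
           [/\ refutation (fun C => H C \/ C \in e.2.2) e.2.1,
               (pwidth e.2.1 <= w)%N &
               (forall C l, C \in e.2.2 -> l \in C -> var_of H l.1)]) &
        (forall x : V -> bool,
           1 - eps <= \sum_(e <- D | cnf_sat x e.2.2) e.1)].

End Resolution.

(* A clause over n variables is a map 'I_n -> option bool (Some true: the   *)
(* positive literal occurs, Some false: the negative one, None: absent).    *)
(* It is an ordinary width-k clause iff exactly k variables occur; there    *)
(* are binom(n,k) 2^k of them.                                              *)
Definition kclause (n : nat) := {ffun 'I_n -> option bool}.
Definition is_kwidth (k n : nat) (C : kclause n) : bool :=
  #|[set v : 'I_n | C v != None]| == k.
Definition kformula (n m : nat) := {ffun 'I_m -> kclause n}.

Definition prob_kcnf (R : realType) (k n m : nat) (P : kformula n m -> Prop) : R :=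
  (#|[set F : kformula n m | [forall j, is_kwidth k (F j)] && `[< P F >]]|%:R)
  / ((#|[set C : kclause n | is_kwidth k C]| ^ m)%N%:R).
Arguments prob_kcnf R k n m P : clear implicits.

(* Variables (kind, node, index):                                           *)
(*   (0,i,v) : literal  v  occurs in C_i          (v < n)                   *)
(*   (1,i,v) : literal ~v  occurs in C_i          (v < n)                   *)
(*   (2,i,0) : tag of node i (true = resolution, false = weakening)         *)
(*   (3,i,b) : bit b of first predecessor pointer (b < w)                   *)
(*   (4,i,b) : bit b of second predecessor pointer (b < w)                  *)
(*   (5,i,b) : bit b of the resolved variable     (b < wv)                  *)
(* Pointers p in [0, 2^w), w = up_log 2 (m + L): p < m refers to the axiom  *)
(* (clause) p of F, m <= p < m + i refers to the earlier node C_(p-m);      *)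
(* other values are invalid.  The resolved variable r is valid iff r < n.   *)
Definition svar := (nat * nat * nat)%type.
Definition vPos (i v : nat) : svar := (0, i, v)%N.
Definition vNeg (i v : nat) : svar := (1, i, v)%N.
Definition vTag (i : nat) : svar := (2, i, 0)%N.
Definition vP1 (i b : nat) : svar := (3, i, b)%N.
Definition vP2 (i b : nat) : svar := (4, i, b)%N.
Definition vRv (i b : nat) : svar := (5, i, b)%N.

Definition ptr_width (m L : nat) : nat := up_log 2 (m + L).
Definition var_width (n : nat) : nat := up_log 2 n.

Definition bin_val (f : nat -> bool) (w : nat) : nat :=
  \sum_(b < w) (f b) * 2 ^ b.

Section SLB.
Variables (n m L : nat) (F : kformula n m).
Let w := ptr_width m L.
Let wv := var_width n.

Definition ptr1 (x : svar -> bool) (i : nat) := bin_val (fun b => x (vP1 i b)) w.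
Definition ptr2 (x : svar -> bool) (i : nat) := bin_val (fun b => x (vP2 i b)) w.
Definition rvar (x : svar -> bool) (i : nat) := bin_val (fun b => x (vRv i b)) wv.

Definition node_lit (x : svar -> bool) (j v : nat) (s : bool) : bool :=
  x (if s then vPos j v else vNeg j v).

Definition ax_lit (p v : nat) (s : bool) : Prop :=
  exists (hp : (p < m)%N) (hv : (v < n)%N), F (Ordinal hp) (Ordinal hv) = Some s.

Definition ptr_ok (i p : nat) : Prop := (p < m + i)%N.

Definition pred_lit (x : svar -> bool) (p v : nat) (s : bool) : Prop :=
  if (p < m)%N then ax_lit p v s else node_lit x (p - m) v s.

Definition node_valid (x : svar -> bool) (i : nat) : Prop :=
  let a := ptr1 x i in let b := ptr2 x i in let r := rvar x i in
  if x (vTag i) then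
    [/\ ptr_ok i a /\ ptr_ok i b, (r < n)%N, pred_lit x a r true, pred_lit x b r false &
        forall v s, (v < n)%N ->
          (node_lit x i v s <->
             ((pred_lit x a v s /\ (v, s) <> (r, true)) \/
              (pred_lit x b v s /\ (v, s) <> (r, false))))]
  else
    ptr_ok i a /\ forall v s, (v < n)%N -> pred_lit x a v s -> node_lit x i v s.

(* variables queried by the verifying decision tree of node i *)
Definition own_vars (i : nat) : seq svar :=
  [seq vPos i v | v <- iota 0 n] ++ [seq vNeg i v | v <- iota 0 n] ++ [:: vTag i]
  ++ [seq vP1 i b | b <- iota 0 w] ++ [seq vP2 i b | b <- iota 0 w]
  ++ [seq vRv i b | b <- iota 0 wv].
Definition pred_vars (i p : nat) : seq svar :=
  if (m <= p < m + i)%N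
  then [seq vPos (p - m) v | v <- iota 0 n] ++ [seq vNeg (p - m) v | v <- iota 0 n]
  else [::].
Definition query_vars (x : svar -> bool) (i : nat) : seq svar :=
  own_vars i ++ pred_vars i (ptr1 x i) ++ pred_vars i (ptr2 x i).

Definition neg_clause (x : svar -> bool) (Q : seq svar) : clause svar :=
  [seq (v, ~~ x v) | v <- Q].

Definition sLB (C : clause svar) : Prop :=
  (* node i is valid: one clause per invalid leaf of the decision tree *)
  (exists i x, (i < L)%N /\ ~ node_valid x i /\ C = neg_clause x (query_vars x i))
  \/ (exists v, (v < n)%N /\ (C = [:: (vPos L.-1 v, false)] \/ C = [:: (vNeg L.-1 v, false)])).

End SLB.

(* Main.v *)
Require Import Defs.
From HB Require Import structures.
From mathcomp Require Import all_boot all_order all_algebra.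
From mathcomp Require Import boolp reals exp.
From mathcomp Require Import zify lra ring.
Set Implicit Arguments. Unset Strict Implicit. Unset Printing Implicit Defensive.
Import Order.TTheory GRing.Theory Num.Theory.

(** A refutation [C_0, ..., C_(L-1)] of [F] ends with the empty clause.  Fix a restriction
    [rho] under which [F] has no refutation of width [d].  Call a clause good if, under
    [rho], it is not derivable from [F] in width [d]; the empty clause is good, the
    axioms are not, and a good clause of width at most [d] has a good premise.  Hence,
    unless some node is wide under [rho], one can walk from the last node to ever
    earlier good nodes while remembering a single node, which is a narrow refutation of
    sLB together with the CNF [B] saying that no node is wide under [rho].

    The random restrictions come from the size-width argument of Ben-Sasson and Wigderson:
    literals are made true at random, each at the price of one unit of width, and literals
    for which this price is too low are falsified for free.  Every fixed clause then
    stays wide only with exponentially small probability, so a union bound over the [L]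
    nodes applies.  The linear width lower bound needed to start follows from the boundary
    expansion of a random k-CNF, whose satisfiability plays no role. *)

(** * Width-bounded derivations and random restrictions *)

Section BoundedWidth.
Variables (V : finType) (Ax : {set V * bool} -> Prop).
Implicit Types (l : V * bool) (rho C D : {set V * bool}).

Definition negl l : V * bool := (l.1, ~~ l.2).

Lemma neglK : involutive negl.
Proof. by case=> v b; rewrite /negl /= negbK. Qed.

Lemma lit_eqP l l' : [\/ l' = l, l' = negl l | l'.1 != l.1].
Proof.
case: l l' => [v b] [v' b'] /=; have [->|/=] := eqVneq v' v; last by constructor 3.
have [->|nb] := eqVneq b' b; first by constructor 1.
by constructor 2; rewrite /negl /=; congr pair; case: b b' nb => [] [].
Qed.

Definition residue rho C := [set l in C | negl l \notin rho].

(* Clauses restricted by [rho], the set of literals made true, are represented by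
   their unrestricted versions: the weakening rule ignores falsified literals.  Only
   resolvents are subject to the width bound. *)
Inductive wder (w : nat) rho : {set V * bool} -> Prop :=
| wder_taut l C : l \in C -> negl l \in C -> wder w rho C
| wder_sat l C : l \in rho -> l \in C -> wder w rho C
| wder_ax A : Ax A -> wder w rho A
| wder_weak D C : wder w rho D -> residue rho D \subset C -> wder w rho C
| wder_res l D1 D2 C : wder w rho D1 -> wder w rho D2 ->
    D1 :\ l \subset C -> D2 :\ negl l \subset C ->
    #|residue rho C| <= w -> wder w rho C.

Lemma residueS rho rho' C C' :
  rho' \subset rho -> C \subset C' -> residue rho C \subset residue rho' C'.
Proof.
move=> /subsetP srho /subsetP sC; apply/subsetP => l; rewrite !inE => /andP[/sC -> /=].
by apply: contra => /srho.
Qed.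

Lemma wder_sub w rho D C : wder w rho D -> D \subset C -> wder w rho C.
Proof.
move=> dD sDC; apply: (wder_weak dD); apply: subset_trans sDC.
by apply/subsetP => l; rewrite inE => /andP[].
Qed.

Lemma wderW w w' rho rho' C :
  w <= w' -> rho \subset rho' -> wder w rho C -> wder w' rho' C.
Proof.
move=> le_w srho; elim=> {C} [l C|l C l_rho|A|D C _ IH sDC|l D1 D2 C _ IH1 _ IH2 s1 s2 wC].
- exact: wder_taut.
- exact: wder_sat (subsetP srho _ l_rho).
- exact: wder_ax.
- by apply: (wder_weak IH); apply: subset_trans sDC; apply: residueS.
- apply: (wder_res (l := l) IH1 IH2 s1 s2); apply: leq_trans le_w; apply: leq_trans wC.
  by rewrite subset_leq_card // residueS.
Qed.

(** Adding [negl l] to every line does the work of the restriction [l]. Residues grow by at most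
    this literal, which is the one unit of width paid. *)
Lemma wder_lift w rho l C :
  wder w (l |: rho) C -> wder w.+1 rho (negl l |: C).
Proof.
elim=> {C} [l' C|l' C|A AxA|D C _ IH sDC|l' D1 D2 C _ IH1 _ IH2 s1 s2 wC].
- by move=> lC nlC; apply: (@wder_taut _ _ l'); rewrite in_setU1 (lC, nlC) orbT.
- case/setU1P=> [->|l'rho] l'C.
    by apply: (@wder_taut _ _ l); rewrite in_setU1 ?l'C ?eqxx ?orbT.
  by apply: (@wder_sat _ _ l') => //; rewrite in_setU1 l'C orbT.
- by apply: wder_sub (wder_ax _ _ AxA) _; apply: subsetUr.
- apply: (wder_weak IH); apply/subsetP => x; rewrite !inE => /andP[/orP[->//|xD] nx].
  have [//|xl /=] := eqVneq x (negl l); apply: (subsetP sDC); rewrite !inE xD /= negb_or nx andbT.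
  by apply: contra xl => /eqP <-; rewrite neglK.
- apply: (wder_res (l := l') IH1 IH2).
  + apply/subsetP => x; rewrite !inE => /andP[xl' /orP[->//|xD]].
    by rewrite (subsetP s1) ?orbT // !inE xl'.
  + apply/subsetP => x; rewrite !inE => /andP[xl' /orP[->//|xD]].
    by rewrite (subsetP s2) ?orbT // !inE xl'.
  + have sub : residue rho (negl l |: C) \subset negl l |: residue (l |: rho) C.
      apply/subsetP => x; rewrite !inE => /andP[/orP[->//|xC] nx].
      have [//|xl /=] := eqVneq x (negl l); rewrite xC /= negb_or nx andbT.
      by apply: contra xl => /eqP <-; rewrite neglK.
    apply: leq_trans (subset_leq_card sub) _; rewrite cardsU1; lia.
Qed.

(** Falsifying [l] is free once the unit clause [negl l] is derived: axioms, of width at most [w],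
    are resolved with it, and lines containing [negl l] are weakenings of it. *)
Lemma wder_unit w rho l C :
  l \notin rho -> (forall A, Ax A -> #|A| <= w) ->
  wder w rho [set negl l] -> wder w (negl l |: rho) C -> wder w rho (C :\ l).
Proof.
move=> l_rho wAx dl.
have dneg D : negl l \in D -> wder w rho (D :\ l).
  move=> nlD; apply: wder_sub dl _; rewrite sub1set !inE nlD andbT.
  by case: (l) => v []; rewrite /negl /= xpair_eqE eqxx.
elim=> {C} [l' C lC nlC|l' C|A AxA|D C _ IH sDC|l' D1 D2 C _ IH1 _ IH2 s1 s2 wC].
- case: (lit_eqP l l') => [e|e|ne].
  + by apply: dneg; rewrite -e.
  + by apply: dneg; rewrite -e.
  + apply: (@wder_taut _ _ l'); rewrite !inE ?lC ?nlC andbT;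
      by apply: contra ne => /eqP <-.
- case/setU1P=> [->|l'rho] l'C; first exact: dneg.
  apply: (@wder_sat _ _ l') => //; rewrite !inE l'C andbT.
  by apply: contraNneq l_rho => <-.
- apply: (@wder_res _ _ l A [set negl l]) => //.
  + exact: wder_ax.
  + by apply/subsetP => x; rewrite !inE; case: eqP.
  + apply: leq_trans (wAx _ AxA); apply/subset_leq_card/subsetP => x.
    by rewrite !inE => /andP[/andP[]].
- apply: (wder_weak IH); apply/subsetP => x; rewrite !inE => /andP[/andP[xl xD] nx].
  rewrite xl /=; apply: (subsetP sDC); rewrite !inE xD /= negb_or nx andbT.
  by apply: contra xl => /eqP /(can_inj neglK) ->.
- have wC' : #|residue rho (C :\ l)| <= w.
    apply: leq_trans wC; apply/subset_leq_card/subsetP => x.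
    rewrite !inE => /andP[/andP[xl ->] nx] /=; rewrite negb_or nx andbT.
    by apply: contra xl => /eqP /(can_inj neglK) ->.
  case: (lit_eqP l l') => [e|e|ne].
  + by apply: wder_sub IH1 _; apply/subsetP => x; rewrite -e !inE => /andP[xl xD];
      rewrite xl (subsetP s1) // !inE xl.
  + apply: wder_sub IH2 _; apply/subsetP => x; rewrite !inE => /andP[xl xD].
    by rewrite xl (subsetP s2) // !inE xD andbT e neglK.
  + apply: (wder_res (l := l') IH1 IH2) wC'.
    * apply/subsetP => x; rewrite !inE => /and3P[xl' xl xD].
      by rewrite xl (subsetP s1) // !inE xl'.
    * apply/subsetP => x; rewrite !inE => /and3P[xl' xl xD].
      by rewrite xl (subsetP s2) // !inE xl'.
Qed.

(** The recursion of Ben-Sasson and Wigderson: the first refutation lifts to a derivation of the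
    unit clause [negl l], which replaces the assumption [negl l] in the second. *)
Lemma wder_split w rho l :
  l \notin rho -> (forall A, Ax A -> #|A| <= w.+1) ->
  wder w (l |: rho) set0 -> wder w.+1 (negl l |: rho) set0 -> wder w.+1 rho set0.
Proof.
move=> l_rho wAx /wder_lift; rewrite setU0 => dl /(wder_unit l_rho wAx dl).
by rewrite set0D.
Qed.

Definition wide_under d rho C := [disjoint C & rho] && (d < #|residue rho C|).

Lemma wide_underS d rho rho' C :
  rho \subset rho' -> wide_under d rho' C -> wide_under d rho C.
Proof.
move=> srho /andP[dC wC]; apply/andP; split.
  by rewrite disjoint_sym; apply: disjointWl srho _; rewrite disjoint_sym.
by apply: leq_trans wC _; rewrite subset_leq_card // residueS.
Qed.

(* The size-width argument of Ben-Sasson and Wigderson with random choices: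
   if [rho] is maximal among the restrictions without refutation of width w+1, then
   every literal not falsified by [rho] can be made true at the price of one unit of
   width, so a wide clause is satisfied by a uniformly random literal with
   probability at least [d / #|literals|]. *)
Lemma restriction_family d t rho :
  (forall A, Ax A -> #|A| <= d) -> ~ wder (d + t) rho set0 ->
  exists s : seq {set V * bool},
    [/\ size s = #|{: V * bool}| ^ t,
        forall r, r \in s -> rho \subset r /\ ~ wder d r set0 &
        forall C, count (fun r => wide_under d r C) s <= (#|{: V * bool}| - d) ^ t].
Proof.
move=> wAx; elim: t rho => [|t IH] rho0 nR0.
  exists [:: rho0]; split=> // [r|C]; last by rewrite /=; case: wide_under.
  by rewrite inE => /eqP ->; rewrite addn0 in nR0.
pose P := [pred r : {set V * bool} | `[< ~ wder (d + t.+1) r set0 >]].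
have [rho /maxsetP[/asboolP nR maxR] s0] := @maxset_exists _ P rho0 (asboolT nR0).
have ext l : exists s : seq {set V * bool},
    [/\ size s = #|{: V * bool}| ^ t,
        forall r, r \in s -> rho \subset r /\ ~ wder d r set0,
        negl l \notin rho -> forall r, r \in s -> l \in r &
        forall C, count (fun r => wide_under d r C) s <= (#|{: V * bool}| - d) ^ t].
  have [nl|nl] := boolP (negl l \in rho).
    have [|s [sz sR sC]] := IH rho; last by exists s; split.
    by move=> R; apply: nR; apply: wderW R => //; rewrite addnS.
  have [|s [sz sR sC]] := IH (l |: rho); last first.
    exists s; split=> // [r /sR[sub ?]|_ r /sR[sub _]].
      by split=> //; apply: subset_trans sub; apply: subsetUr.
    by apply: (subsetP sub); rewrite setU11.
  (* By maximality, falsifying [l] gives a refutation of width [d + t.+1]; one of width [d + t] with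
     [l] true would then combine with it into a refutation under [rho] itself. *)
  move=> R; apply: nR; have [l_rho|l_rho] := boolP (l \in rho).
    apply: wderW R; first by rewrite addnS.
    by rewrite (setUidPr _) ?sub1set.
  rewrite addnS; apply: (wder_split l_rho) R _.
    by move=> A /wAx h; apply: leq_trans h _; rewrite -addnS leq_addr.
  apply: contrapT; rewrite -addnS => nR'.
  have e := maxR _ (asboolT nR') (subsetUr _ _).
  by move: nl; rewrite -e setU11.
have [S SP] := choice ext.
(* The list, with repetitions, stands for a uniform distribution: a uniform first literal, then [t]
   further choices from [S l]. *)
exists (flatten [seq S l | l <- enum {: V * bool}]); split.
- rewrite size_flatten /shape -map_comp (eq_map (g := fun=> #|{: V * bool}| ^ t)).
    by rewrite sumnE big_map big_const_seq count_predT iter_addn_0 -cardT mulnC expnS.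
  by move=> l /=; case: (SP l).
- move=> r /flattenP[_ /mapP[l _ ->]] rS; have [_ /(_ r rS)[sub nRr] _ _] := SP l.
  by split=> //; apply: subset_trans sub.
- move=> C; rewrite count_flatten -map_comp sumnE big_map big_enum /=.
  have [wC|nwC] := boolP (wide_under d rho C); last first.
    rewrite big1 // => l _; apply/eqP; rewrite -leqn0 leqNgt -has_count.
    apply/hasPn => r rS; apply: contra nwC; apply: wide_underS.
    by have [_ /(_ r rS)[]] := SP l.
  (* Making a literal of the residue true satisfies [C], so more than [d] literals contribute
     nothing. *)
  rewrite (bigID (mem (residue rho C))) /= big1 => [|l]; last first.
    rewrite inE => /andP[lC nl].
    apply/eqP; rewrite -leqn0 leqNgt -has_count; apply/hasPn => r rS.
    have [_ _ /(_ nl _ rS) lr _] := SP l.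
    by apply/negP => /andP[dC _]; rewrite (disjointFl dC lr) in lC.
  rewrite add0n; have leS l : l \notin residue rho C ->
      count (fun r => wide_under d r C) (S l) <= (#|{: V * bool}| - d) ^ t.
    by have [_ _ _] := SP l.
  apply: (@leq_trans (\sum_(l | l \notin residue rho C) (#|{: V * bool}| - d) ^ t)).
    by apply: leq_sum => l /leS.
  rewrite sum_nat_const expnS leq_mul2r; apply/orP; right.
  case/andP: wC => _ wC; have := cardC (mem (residue rho C)).
  set a := #|mem _|; set b := #|[predC _]| => e.
  have {wC}: d < a by [].
  by rewrite -{}e; clear; lia.
Qed.

End BoundedWidth.

(** * Width lower bounds from expansion *)

Section Expansion.
Variables (V J : finType) (cls : J -> {set V * bool}).
Implicit Types (C : {set V * bool}) (S : {set J}) (a : V -> bool).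

Definition vars C : {set V} := [set l.1 | l in C].

Definition boundary S : {set V} := [set v | #|[set j in S | v \in vars (cls j)]| == 1].

Definition satisfies a C := exists2 l, l \in C & a l.1 = l.2.

Definition entails S C :=
  forall a, (forall j, j \in S -> satisfies a (cls j)) -> satisfies a C.

Lemma entailsS S S' C C' :
  S \subset S' -> C \subset C' -> entails S C -> entails S' C'.
Proof.
move=> /subsetP sS /subsetP sC SC a aS'; have [|l lC al] := SC a.
  by move=> j /sS; apply: aS'.
by exists l => //; apply: sC.
Qed.

Lemma satisfies_flip a v b C :
  satisfies a C -> v \notin vars C ->
  satisfies (fun u => if u == v then b else a u) C.
Proof.
case=> l lC al nv; exists l => //; case: eqP => // e.
by case/negP: nv; rewrite -e imset_f.
Qed.

(** Take a minimal entailing [S']. If a boundary variable, occurring in clause [j] only, were absent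
    from [C], an assignment satisfying the rest and falsifying [C] could be flipped there to satisfy
    [j] too. *)
Lemma entails_boundary S C : entails S C ->
  exists S', [/\ S' \subset S, entails S' C & boundary S' \subset vars C].
Proof.
move=> SC; pose P := [pred S' : {set J} | `[< entails S' C >]].
have [S' /minsetP[/asboolP S'C minS'] sS'] := @minset_exists _ P S (asboolT SC).
exists S'; split=> //; apply/subsetP => v; rewrite inE => /cards1P[j defj].
have /setIdP[jS' vj] : j \in [set j in S' | v \in vars (cls j)] by rewrite defj set11.
apply: contraT => vC.
have : ~ entails (S' :\ j) C.
  move=> h; have := minS' _ (asboolT h) (subD1set _ _).
  by move/setP/(_ j); rewrite !inE eqxx jS'.
move=> h; exfalso; apply: h => a aS; apply: contrapT => naC.
have /imsetP[l lj vl] := vj.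
apply: naC; pose a' u := if u == v then l.2 else a u.
have [j'|l' l'C al'] := S'C a'.
  have [-> _|ne j'S'] := eqVneq j' j; first by exists l => //; rewrite /a' vl eqxx.
  apply: satisfies_flip; first by apply: aS; rewrite !inE ne.
  apply: contra ne => vj'; rewrite -in_set1 -defj inE j'S'; exact: vj'.
exists l' => //; move: al'; rewrite /a'; case: eqP => // e.
by case/negP: vC; rewrite -e imset_f.
Qed.

Definition expanding (r : nat) := forall S, #|S| <= r -> #|S| <= 2 * #|boundary S|.

Lemma entails_card r S C : expanding r -> #|S| <= r -> entails S C ->
  exists2 S' : {set J}, #|S'| <= 2 * #|C| & entails S' C.
Proof.
move=> expS Sr /entails_boundary[S' [sS S'C bS']]; exists S' => //.
have /expS le1 : #|S'| <= r by apply: leq_trans Sr; apply: subset_leq_card.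
apply: leq_trans le1 _; rewrite leq_mul2l /=.
by apply: leq_trans (subset_leq_card bS') _; apply: leq_imset_card.
Qed.

(* A clause of width at most [w] entailed by [4 w] input clauses is entailed by
   [2 w] of them, as a minimal such set has its boundary among the variables of the clause. *)
Lemma expanding_width w : 0 < w -> expanding (4 * w) ->
  ~ wder (fun A => exists j, A = cls j) w set0 set0.
Proof.
move=> w0 expS.
have res0 C : residue set0 C = C by apply/setP => l; rewrite !inE andbT.
suff main C : wder (fun A => exists j, A = cls j) w set0 C ->
    exists2 S : {set J}, #|S| <= 2 * w & entails S C.
  (* For the empty clause the bound [2 * #|C|] leaves no input clause at all, and the empty set does
     not entail it. *)
  move=> /main[S Sw S0]; have [|S'] := entails_card expS _ S0; first lia.
  rewrite cards0 leqn0 cards_eq0 => /eqP -> /(_ (fun=> true)) [j|l].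
    by rewrite inE.
  by rewrite inE.
elim=> {C} [l C lC nlC|l C|A [j ->]|D C _ [S Sw SD]|l D1 D2 C _ [S1 w1 e1] _ [S2 w2 e2] s1 s2].
- exists set0; first by rewrite cards0.
  move=> a _; have [e|e] := eqVneq (a l.1) l.2; first by exists l.
  by exists (negl l) => //=; case: (a _) (l.2) e => [] [].
- by rewrite inE.
- exists [set j]; first by rewrite cards1; lia.
  by move=> a; apply; rewrite set11.
- by rewrite res0 => sDC; exists S => //; apply: entailsS SD.
- rewrite res0 => Cw.
  have [||S Sw SC] := @entails_card _ (S1 :|: S2) C expS.
  + have := (leq_card_setU S1 S2 : _ <= _); lia.
  + move=> a aS.
    have [|l1 l1D al1] := e1 a; first by move=> j jS; apply: aS; rewrite inE jS.
    have [|l2 l2D al2] := e2 a; first by move=> j jS; apply: aS; rewrite inE jS orbT.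
    have [e|ne] := eqVneq l1 l; last by exists l1 => //; apply: (subsetP s1); rewrite !inE ne.
    exists l2 => //; apply: (subsetP s2); rewrite !inE l2D andbT.
    by apply/eqP => e'; move: al2; rewrite e' /= -e al1; case: (l1.2).
  + by exists S => //; apply: leq_trans Sw _; rewrite leq_mul2l.
Qed.

End Expansion.

(** * Refuting sLB when no node is wide *)

Section BoundedResolution.
Variables (V : eqType) (Ax : clause V -> Prop) (W : nat).
Implicit Types (A C D : clause V) (P : seq (clause V)).

(** An inductive form of refutability, suited to recursive construction. Bounding [size] also bounds
    the width, which ignores repeated literals. *)
Inductive resder : clause V -> Prop :=
| resder_ax A C : Ax A -> {subset A <= C} -> size C <= W -> resder C
| resder_weak D C : resder D -> {subset D <= C} -> size C <= W -> resder C
| resder_res D1 D2 v C : resder D1 -> resder D2 -> (v, true) \in D1 -> (v, false) \in D2 ->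
    (forall l, l \in D1 -> l != (v, true) -> l \in C) ->
    (forall l, l \in D2 -> l != (v, false) -> l \in C) -> size C <= W -> resder C.

Definition derivation P := forall i, i < size P -> res_step Ax (take i P) (nth [::] P i).

Lemma res_step_mono P P' C :
  {subset P <= P'} -> res_step Ax P C -> res_step Ax P' C.
Proof.
move=> sP [?|[[D [DP DC]]|[D1 [D2 [v [[D1P D2P] v1 v2 h1 h2]]]]]]; first by left.
  by right; left; exists D; split=> //; apply: sP.
by right; right; exists D1, D2, v; split=> //; split; apply: sP.
Qed.

Lemma derivation_cat P1 P2 : derivation P1 -> derivation P2 -> derivation (P1 ++ P2).
Proof.
move=> d1 d2 i; rewrite size_cat take_cat nth_cat => lt_i; case: ltnP => le_i.
  exact: d1.
apply: res_step_mono (d2 (i - size P1) _); last by rewrite ltn_subLR.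
by move=> D DP; rewrite mem_cat DP orbT.
Qed.

Lemma derivation_rcons P C : derivation P -> res_step Ax P C -> derivation (rcons P C).
Proof.
move=> dP CP i; rewrite size_rcons ltnS leq_eqVlt => /orP[/eqP->|lt_i].
  by rewrite nth_rcons ltnn eqxx -cats1 take_size_cat.
by rewrite nth_rcons lt_i -cats1 takel_cat 1?ltnW //; apply: dP.
Qed.

Lemma resder_derivation C : resder C ->
  exists P, [/\ derivation P, C \in P & all (fun D => size D <= W) P].
Proof.
have width1 P C' : all (fun D => size D <= W) P -> size C' <= W ->
  all (fun D => size D <= W) (rcons P C') by move=> *; rewrite all_rcons; apply/andP.
elim=> {C} [A C AxA sAC CW|D C _ [P [dP DP PW]] sDC CW|
            D1 D2 v C _ [P1 [d1 D1P W1]] _ [P2 [d2 D2P W2]] v1 v2 s1 s2 CW].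
- exists (rcons [::] C); rewrite mem_rcons mem_head; split=> //; last exact: width1.
  by apply: derivation_rcons => //; left; exists A.
- exists (rcons P C); rewrite mem_rcons mem_head; split=> //; last exact: width1.
  by apply: derivation_rcons => //; right; left; exists D.
- exists (rcons (P1 ++ P2) C); rewrite mem_rcons mem_head; split=> //.
    apply: derivation_rcons; first exact: derivation_cat.
    by right; right; exists D1, D2, v; split=> //; rewrite !mem_cat D1P D2P orbT.
  by apply: width1 => //; rewrite all_cat W1.
Qed.

Lemma resder_refutation : resder [::] -> exists2 P, refutation Ax P & pwidth P <= W.
Proof.
move=> /resder_derivation[P [dP nilP /allP PW]]; exists P => //.
apply/bigmax_leqP_seq => C /PW CW _.
exact: leq_trans (size_undup _) CW.
Qed.

End BoundedResolution.

Lemma mem_neg_clause x Q u b : ((u, b) \in neg_clause x Q) = (u \in Q) && (b == ~~ x u).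
Proof.
apply/mapP/andP => [[v vQ [-> ->]]//|[uQ /eqP->]]; by exists u.
Qed.

Lemma neg_clause_eq x y Q : {in Q, x =1 y} -> neg_clause x Q = neg_clause y Q.
Proof. by move=> exy; apply/eq_in_map => u /exy ->. Qed.

Lemma neg_clause_sub x Q Q' : {subset Q <= Q'} -> {subset neg_clause x Q <= neg_clause x Q'}.
Proof. by move=> sQ [u b]; rewrite !mem_neg_clause => /andP[/sQ-> ->]. Qed.

Lemma clause_satPn x y Q : ~~ clause_sat x (neg_clause y Q) -> {in Q, x =1 y}.
Proof.
move/hasPn => h u uQ; apply/eqP.
have /h : (u, ~~ y u) \in neg_clause y Q by rewrite mem_neg_clause uQ eqxx.
by rewrite /lit_sat /=; case: (x u) (y u) => [] [].
Qed.

(** Resolution simulates a decision tree: the clause at a tree node negates the answers [y] on [Q0]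
    given so far, and the two clauses below a query of [v] are resolved on [v]. A repeated query
    does not branch and costs only a weakening. *)
Lemma resder_query Ax W y Q0 Q : size (Q0 ++ Q) <= W ->
  (forall x, {in Q0, x =1 y} -> resder Ax W (neg_clause x (Q0 ++ Q))) ->
  resder Ax W (neg_clause y Q0).
Proof.
elim: Q Q0 y => [|v Q IH] Q0 y szW dQ; first by rewrite -[Q0]cats0; apply: dQ.
have szW0 : size (neg_clause y Q0) <= W.
  by rewrite size_map; apply: leq_trans szW; rewrite size_cat leq_addr.
have [vQ0|vQ0] := boolP (v \in Q0).
  apply: (resder_weak (D := neg_clause y (rcons Q0 v))) => //; last first.
    by apply: neg_clause_sub => u; rewrite mem_rcons inE => /predU1P[->|].
  apply: IH => [|x exy]; rewrite cat_rcons //; apply: dQ => u uQ0.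
  by apply: exy; rewrite mem_rcons inE uQ0 orbT.
pose y' b u := if u == v then b else y u.
have eqy b : {in Q0, y' b =1 y}.
  by move=> u uQ0; rewrite /y'; case: eqP uQ0 vQ0 => // -> ->.
have dy b : resder Ax W (neg_clause (y' b) (rcons Q0 v)).
  apply: IH => [|x exy]; rewrite cat_rcons //; apply: dQ => u uQ0.
  by rewrite -(eqy b) // exy // mem_rcons inE uQ0 orbT.
have eqv b : y' b v = b by rewrite /y' eqxx.
have rest b l : l \in neg_clause (y' b) (rcons Q0 v) -> l != (v, ~~ b) ->
    l \in neg_clause y Q0.
  case: l => u c; rewrite !mem_neg_clause mem_rcons inE => /andP[/predU1P[->|uQ0] /eqP->].
    by rewrite eqv eqxx.
  by rewrite eqy // uQ0 eqxx.
(* Answering false puts the literal [(v, true)] into the clause, so that branch is the positive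
   premise. *)
apply: (resder_res (dy false) (dy true) (v := v)) => //; try exact: rest;
  by rewrite mem_neg_clause mem_rcons mem_head eqv.
Qed.

(** * The walk through good nodes *)

Section Walk.
Variables (n m L : nat) (F : kformula n m) (d : nat) (rho : {set 'I_n * bool}).
Implicit Types (x : svar -> bool) (C : {set 'I_n * bool}).

Definition kclause_lits (C : kclause n) : {set 'I_n * bool} := [set l | C l.1 == Some l.2].

Definition node_clause x i : {set 'I_n * bool} := [set l | node_lit x i (val l.1) l.2].

Definition node_vars i : seq svar :=
  [seq vPos i v | v <- iota 0 n] ++ [seq vNeg i v | v <- iota 0 n].

(** The node index is ignored, so that [C] is written at all nodes at once; only the literal
    variables (kinds 0 and 1) matter. *)
Definition encode C (u : svar) : bool :=
  if insub u.2 is Some v then (v, u.1.1 == 0) \in C else false.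

Lemma encodeK C i : node_clause (encode C) i = C.
Proof.
by apply/setP => -[v []]; rewrite inE /node_lit /encode [insub _](valK v).
Qed.

Lemma node_varsP i v b : v < n -> (if b then vPos i v else vNeg i v) \in node_vars i.
Proof.
by move=> vn; rewrite mem_cat; case: b; apply/orP; [left|right]; rewrite map_f // mem_iota.
Qed.

Lemma node_clause_eq x y i : {in node_vars i, x =1 y} -> node_clause x i = node_clause y i.
Proof. by move=> exy; apply/setP => l; rewrite !inE; apply/exy/node_varsP/ltn_ord. Qed.

Lemma node_vars_eq x y i : node_clause x i = node_clause y i -> {in node_vars i, x =1 y}.
Proof.
move=> e u; rewrite mem_cat => /orP[] /mapP[v]; rewrite mem_iota => /andP[_ vn] ->.
  by have /setP/(_ (Ordinal vn, true)) := e; rewrite !inE.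
by have /setP/(_ (Ordinal vn, false)) := e; rewrite !inE.
Qed.

(** The CNF [B] of the random refutation: each clause forbids one wide clause at one node. *)
Definition bad_cnf : cnf svar :=
  [seq neg_clause (encode C) (node_vars i)
     | i <- iota 0 L, C <- [seq C <- enum {set 'I_n * bool} | wide_under d rho C]].

Lemma bad_cnf_mem x i : i < L -> wide_under d rho (node_clause x i) ->
  neg_clause x (node_vars i) \in bad_cnf.
Proof.
move=> iL wC; apply/allpairsP; exists (i, node_clause x i); split=> /=.
- by rewrite mem_iota.
- by rewrite mem_filter wC mem_enum.
- by apply/neg_clause_eq/node_vars_eq; rewrite encodeK.
Qed.

Lemma bad_cnf_sat x : (forall i, i < L -> ~~ wide_under d rho (node_clause x i)) ->
  cnf_sat x bad_cnf.
Proof.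
move=> h; apply/allP => D /allpairsP[[i C] /= [iL]].
rewrite mem_filter => /andP[wC _] ->; apply: contraT => /clause_satPn/node_clause_eq e.
by move: iL; rewrite mem_iota => /andP[_ /h]; rewrite e encodeK wC.
Qed.

Let Der := wder (fun A => exists j, A = kclause_lits (F j)) d rho.

Definition pred_clause x p : {set 'I_n * bool} :=
  if insub p is Some j then kclause_lits (F j) else node_clause x (p - m).

Lemma pred_litP x p (v : 'I_n) s : pred_lit F x p v s <-> (v, s) \in pred_clause x p.
Proof.
rewrite /pred_lit /pred_clause; case: insubP => [j pm ej|/negbTE->]; last by rewrite inE.
rewrite pm inE /=; split=> [[hp [hv /eqP]]|/eqP e].
  by have -> : Ordinal hp = j by [apply: val_inj]; have -> : Ordinal hv = v by apply: val_inj.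
exists pm, (ltn_ord v); rewrite -e.
by have -> : Ordinal pm = j by [apply: val_inj]; have -> : Ordinal (ltn_ord v) = v by apply: val_inj.
Qed.

(** By contraposition: input clauses are derivable, so if all earlier nodes pointed to were
    derivable, the inference checked at node [i] would derive its clause. *)
Lemma valid_node_pred x i : node_valid L F x i ->
  ~~ wide_under d rho (node_clause x i) -> ~ Der (node_clause x i) ->
  exists p, [/\ p = ptr1 m L x i \/ p = ptr2 m L x i, m <= p < m + i &
                ~ Der (node_clause x (p - m))].
Proof.
move=> Nv nw nD; apply: contrapT => nE; apply: nD.
have Dp p : p = ptr1 m L x i \/ p = ptr2 m L x i -> p < m + i -> Der (pred_clause x p).
  move=> ep pi; rewrite /pred_clause; case: insubP => [j _ _|].
    by apply: wder_ax; exists j.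
  rewrite -leqNgt => mp; apply: contrapT => nD; apply: nE.
  by exists p; rewrite mp pi.
move: Nv; rewrite /node_valid; case: ifP => _; last first.
  move=> [ok sub]; apply: wder_sub (Dp _ (or_introl erefl) ok) _.
  by apply/subsetP => [[v s]] /pred_litP h; rewrite inE; apply: sub h; apply: ltn_ord.
case=> [[ok1 ok2] rn _ _ iffC].
have D1 := Dp _ (or_introl erefl) ok1; have D2 := Dp _ (or_intror erefl) ok2.
(* A clause that is not wide is either satisfied by [rho] or narrow enough for the resolution
   rule. *)
move: nw; rewrite /wide_under negb_and => /orP[|].
  rewrite -setI_eq0 => /set0Pn[l /setIP[lC lr]]; exact: wder_sat lr lC.
rewrite -leqNgt => wC.
pose r := Ordinal rn; apply: (wder_res (l := (r, true)) D1 D2) wC.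
  apply/subsetP => [[v s]]; rewrite !inE => /andP[ne /pred_litP vs] /=.
  apply/iffC; first exact: ltn_ord.
  left; split=> // -[ev es]; move: ne; rewrite es xpair_eqE eqxx andbT.
  by rewrite -val_eqE /= ev eqxx.
apply/subsetP => [[v s]]; rewrite !inE => /andP[ne /pred_litP vs] /=.
apply/iffC; first exact: ltn_ord.
right; split=> // -[ev es]; move: ne; rewrite es xpair_eqE eqxx andbT.
by rewrite -val_eqE /= ev eqxx.
Qed.

(** Three clauses of [2 * n] bits each (a node and its two predecessors), a tag, two pointers and a
    resolved variable. *)
Definition query_bound := 6 * n + 1 + 2 * ptr_width m L + var_width n.

Lemma size_node_vars i : size (node_vars i) = 2 * n.
Proof. by rewrite size_cat !size_map size_iota; lia. Qed.

Lemma size_own_vars i : size (own_vars n m L i) = 2 * n + 1 + 2 * ptr_width m L + var_width n.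
Proof. by rewrite !size_cat !size_map !size_iota /=; lia. Qed.

Lemma size_pred_vars i p : size (pred_vars n m i p) <= 2 * n.
Proof. by rewrite /pred_vars; case: ifP => //= _; rewrite size_cat !size_map size_iota; lia. Qed.

Lemma size_query_vars x i : size (query_vars n m L x i) <= query_bound.
Proof.
rewrite /query_vars size_cat size_own_vars size_cat /query_bound.
have := size_pred_vars i (ptr1 m L x i); have := size_pred_vars i (ptr2 m L x i); lia.
Qed.

Definition inference_vars i : seq svar :=
  [:: vTag i] ++ [seq vP1 i b | b <- iota 0 (ptr_width m L)]
  ++ [seq vP2 i b | b <- iota 0 (ptr_width m L)] ++ [seq vRv i b | b <- iota 0 (var_width n)].

Lemma node_vars_own i : own_vars n m L i = node_vars i ++ inference_vars i.
Proof. by rewrite /node_vars -catA. Qed.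

Lemma ptr_eq x y i : {in own_vars n m L i, x =1 y} ->
  ptr1 m L x i = ptr1 m L y i /\ ptr2 m L x i = ptr2 m L y i.
Proof.
move=> exy; split; rewrite /ptr1 /ptr2 /bin_val; apply: eq_bigr => b _; rewrite exy //.
  by rewrite !mem_cat map_f ?orbT // mem_iota ltn_ord.
by rewrite !mem_cat (map_f (vP2 i)) ?orbT // mem_iota ltn_ord.
Qed.

Let Hyp (A : clause svar) := sLB L F A \/ A \in bad_cnf.

(** Induction along the walk: query the inference of node [i], then the clauses it points to. Either
    a clause of sLB or of [bad_cnf] is falsified, or a good predecessor is found and all else is
    forgotten. *)
Lemma node_refuted i x : i < L -> ~ Der (node_clause x i) ->
  resder Hyp query_bound (neg_clause x (node_vars i)).
Proof.
elim/ltn_ind: i x => i IH x iL nD.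
have szN : size (neg_clause x (node_vars i)) <= query_bound.
  by rewrite size_map size_node_vars /query_bound; lia.
have [wC|nwC] := boolP (wide_under d rho (node_clause x i)).
  apply: (resder_ax (A := neg_clause x (node_vars i))) => //.
  by right; apply: bad_cnf_mem.
apply: (resder_query (Q := inference_vars i)) => [|y]; rewrite -node_vars_own.
  by rewrite size_own_vars /query_bound; lia.
move=> eyx; apply: (resder_query (Q := pred_vars n m i (ptr1 m L y i) ++
  pred_vars n m i (ptr2 m L y i))) => [|z ezy]; first exact: size_query_vars.
have [e1 e2] := ptr_eq ezy; rewrite -e1 -e2.
have Nzx : node_clause z i = node_clause x i.
  apply: node_clause_eq => u uN; rewrite ezy ?eyx //.
  by rewrite node_vars_own mem_cat uN.
have [Nv|nNv] := pselect (node_valid L F z i); last first.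
  apply: (resder_ax (A := neg_clause z (query_vars n m L z i))) => //.
    by left; left; exists i, z.
  by rewrite size_map; apply: size_query_vars.
have [||p [ep mp nDp]] := valid_node_pred Nv; rewrite ?Nzx //.
have lt_i : p - m < i by lia.
(* Forgetting all but the good predecessor is, in resolution, a weakening of its clause. *)
apply: (resder_weak (IH _ lt_i z (ltn_trans lt_i iL) nDp)); last first.
  by rewrite size_map; apply: size_query_vars.
apply: neg_clause_sub => u up; rewrite !mem_cat.
have up' : u \in pred_vars n m i p by rewrite /pred_vars mp.
by case: ep up' => <- ->; rewrite !orbT.
Qed.

Lemma sLB_refuted : 0 < L -> ~ Der set0 ->
  exists2 P, refutation Hyp P & pwidth P <= query_bound.
Proof.
move=> L0 nD; apply: resder_refutation.
(* Nothing is queried yet, so [xpred0] is arbitrary. The unit clauses of sLB exclude every last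
   clause but the empty one, which is good. *)
apply: (resder_query (y := xpred0) (Q0 := [::]) (Q := node_vars L.-1)) => /= [|x _].
  by rewrite size_node_vars /query_bound; lia.
have szN : size (neg_clause x (node_vars L.-1)) <= query_bound.
  by rewrite size_map size_node_vars /query_bound; lia.
have [e0|/set0Pn[[v s] vs]] := eqVneq (node_clause x L.-1) set0.
  by apply: node_refuted; rewrite ?e0 //; lia.
have szl u : u \in node_vars L.-1 -> x u ->
    {subset [:: (u, false)] <= neg_clause x (node_vars L.-1)}.
  by move=> uN xu l; rewrite inE => /eqP->; rewrite mem_neg_clause uN xu.
move: vs; rewrite inE /node_lit /= => xv.
apply: (resder_ax (A := [:: (if s then vPos L.-1 v else vNeg L.-1 v, false)])) => //.
  by left; right; exists (val v); split; [exact: ltn_ord | case: (s); [left|right]].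
by apply: szl xv; apply/node_varsP/ltn_ord.
Qed.

Lemma bad_cnf_vars (C : clause svar) l : C \in bad_cnf -> l \in C -> var_of (sLB L F) l.1.
Proof.
case/allpairsP=> [[i C'] /= [iL _ ->]]; case: l => u b; rewrite mem_neg_clause => /andP[uN _] /=.
move: iL; rewrite mem_iota => /andP[_ iL].
(* A resolution node whose pointers and resolved variable are all 0 is invalid: its two premises
   coincide, and neither an input clause nor an all-zero node contains variable 0 in both signs. *)
pose x (u : svar) := u == vTag i.
exists (neg_clause x (query_vars n m L x i)); split; last first.
  by rewrite -map_comp map_id /query_vars node_vars_own -catA mem_cat uN.
left; exists i, x; split=> //; split=> //; rewrite /node_valid {1}/x eqxx.
have p0 (f : nat -> bool) w : f =1 xpred0 -> bin_val f w = 0.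
  by move=> f0; rewrite /bin_val big1 // => j _; rewrite f0.
rewrite /ptr1 /ptr2 /rvar !p0 //; case=> _ _.
rewrite /pred_lit; case: ifP => // _ [hp [hv e]] [hp' [hv' e']].
by rewrite (bool_irrelevance hp' hp) (bool_irrelevance hv' hv) e in e'.
Qed.

End Walk.

(** * The distribution over refutations *)

Lemma leq_count_exists (T : eqType) (I : finType) (P : I -> pred T) (s : seq T) :
  count (fun x => [exists i, P i x]) s <= \sum_i count (P i) s.
Proof.
elim: s => [|x s IH] /=; first by rewrite big1.
rewrite big_split /=; apply: leq_add => //; case: existsP => // -[i Pix].
by rewrite (bigD1 i) //= Pix.
Qed.

(** The restriction is uniform in the list of [restriction_family]. [B] fails only if one of the [L]
    nodes is wide under it, hence the factor [L] of a union bound. *)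
Lemma sLB_random_refutation (R : realType) n m L (F : kformula n m) d t :
  0 < n -> 0 < L -> (forall j, #|kclause_lits (F j)| <= d) ->
  ~ wder (fun A => exists j, A = kclause_lits (F j)) (d + t) set0 set0 ->
  random_refutation (sLB L F)
    (L%:R * ((2 * n - d)%:R / (2 * n)%:R) ^+ t : R)%R (query_bound n m L).
Proof.
move=> n0 L0 Fd nR.
have axd (A : {set 'I_n * bool}) : (exists j, A = kclause_lits (F j)) -> #|A| <= d by case=> j ->.
have [s [sz sR sC]] := restriction_family axd nR.
have cardN : #|{: 'I_n * bool}| = 2 * n by rewrite card_prod card_ord card_bool mulnC.
rewrite cardN in sz sC.
(* The membership condition sits under the existential so that choice gives a total function, with
   default [[::]] outside [s]. *)
have refP r : exists P, r \in s ->
    refutation (fun C => sLB L F C \/ C \in bad_cnf L d r) P /\ (pwidth P <= query_bound n m L).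
  have [rs|nrs] := boolP (r \in s); last by exists [::].
  by have [_ /(sLB_refuted L0)[P ? ?]] := sR r rs; exists P.
have [P PP] := choice refP.
pose p : R := (((2 * n) ^ t)%:R^-1)%R.
have N0 : (((2 * n) ^ t)%:R != 0 :> R)%R by rewrite pnatr_eq0 -lt0n expn_gt0; lia.
have p0 : (0 <= p)%R by rewrite invr_ge0.
exists [seq (p, (P r, bad_cnf L d r)) | r <- s]; split.
- by move=> _ /mapP[r _ ->].
- rewrite big_map /= big_const_seq count_predT sz iter_addr_0.
  by rewrite -mulr_natl mulfV.
- move=> _ /mapP[r rs ->] _ /=; have [P1 P2] := PP r rs; split=> //.
  by move=> C l; apply: bad_cnf_vars.
- move=> x; rewrite big_map /= big_const_seq iter_addr_0 lerBlDr.
  set a := count _ s.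
  have : (2 * n) ^ t <= a + L * (2 * n - d) ^ t.
    rewrite -sz -(count_predC (fun r => cnf_sat x (bad_cnf L d r))) leq_add2l.
    apply: (@leq_trans (count (fun r => [exists i : 'I_L, wide_under d r (node_clause n x i)]) s)).
      apply: sub_count => r /=; apply: contraR => /existsPn h.
      by apply: bad_cnf_sat => i iL; apply: (h (Ordinal iL)).
    apply: leq_trans (leq_count_exists _ _) _.
    apply: (@leq_trans (\sum_(i < L) (2 * n - d) ^ t)); first by apply: leq_sum => i _; apply: sC.
    by rewrite sum_nat_const card_ord.
  rewrite -(ler_nat R) natrD natrM => h.
  rewrite /p -[(_ *+ a)%R]mulr_natl expr_div_n -!natrX mulrA -mulrDl ler_pdivlMr ?mul1r //.
  by rewrite ltr0n expn_gt0; lia.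
Qed.

(** * Expansion of random formulas *)

Lemma ex_superset_card (T : finType) (A : {set T}) b :
  #|A| <= b <= #|T| -> exists2 B : {set T}, A \subset B & #|B| = b.
Proof.
elim: b => [|b IH] /andP[Ab bT].
  by exists A => //; apply/eqP; rewrite -leqn0.
move: Ab; rewrite leq_eqVlt => /orP[/eqP <-|]; first by exists A.
rewrite ltnS => Ab; have [|B AB Bb] := IH; first by rewrite Ab ltnW.
have /card_gt0P[x] : 0 < #|~: B| by rewrite cardsCs setCK Bb subn_gt0.
rewrite inE => xB; exists (x |: B); first by apply: subset_trans AB (subsetUr _ _).
by rewrite cardsU1 xB Bb.
Qed.

Section Counting.
Variables (k n : nat).
Implicit Types (N : {set 'I_n}) (C : kclause n).

Definition supp C : {set 'I_n} := [set v | C v != None].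

Lemma vars_kclause_lits C : vars (kclause_lits C) = supp C.
Proof.
apply/setP => v; rewrite inE; apply/imsetP/idP => [[l]|].
  by rewrite inE => /eqP e ->; rewrite e.
by case e: (C v) => [b|//] _; exists (v, b) => //; rewrite inE /= e.
Qed.

Lemma card_kclause_lits C : #|kclause_lits C| = #|supp C|.
Proof.
rewrite -vars_kclause_lits card_in_imset // => -[v b] [v' b'].
by rewrite !inE /= => /eqP e1 /eqP e2 ev; move: e1 e2; rewrite ev => -> [->].
Qed.

Lemma card_supp N : #|[set C : kclause n | supp C == N]| = 2 ^ #|N|.
Proof.
have <- : #|pred2 (Some true) (Some false)| = 2 by rewrite card2.
rewrite -(card_pffun_on None N); apply: eq_card => C; rewrite inE.
apply/eqP/pffun_onP => [<-|[s1 s2]].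
  split=> [|o /imageP[v]]; first by apply/subsetP => v; rewrite !inE.
  by rewrite !inE => + ->; case: (C v) => [[]|].
apply/setP => v; rewrite inE; apply/idP/idP => [h|vN]; first by apply: (subsetP s1).
have /s2 : C v \in image C N by apply: image_f.
by rewrite !inE; case: (C v).
Qed.

Lemma card_kwidth_sub N :
  #|[set C : kclause n | is_kwidth k C & supp C \subset N]| = 'C(#|N|, k) * 2 ^ k.
Proof.
rewrite -sum1_card (partition_big supp (mem [set A : {set 'I_n} | A \subset N & #|A| == k])) /=.
  rewrite (eq_bigr (fun=> 2 ^ k)) => [|A]; first by rewrite sum_nat_const cards_draws.
  rewrite inE => /andP[AN /eqP Ak]; rewrite sum1_card -{}Ak -card_supp; apply: eq_card => C.
  transitivity ((C \in [set C : kclause n | is_kwidth #|A| C & supp C \subset N]) && (supp C == A)) => //.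
  by rewrite !inE; case: eqP => [e|]; rewrite ?andbF ?andbT // e AN -e /is_kwidth eqxx.
by move=> C; rewrite inE => /andP[kC CN]; rewrite !inE CN.
Qed.

Lemma card_kwidth : #|[set C : kclause n | is_kwidth k C]| = 'C(n, k) * 2 ^ k.
Proof.
rewrite -[n in 'C(n, _)]card_ord -cardsT -card_kwidth_sub; apply: eq_card => C.
by rewrite !inE subsetT andbT.
Qed.

Variable m : nat.
Implicit Types (F : kformula n m) (J : {set 'I_m}).

Definition confined J N : {set kformula n m} :=
  [set F : kformula n m | [forall j, is_kwidth k (F j)] && [forall (j | j \in J), supp (F j) \subset N]].

Lemma card_confined J N :
  #|confined J N| = ('C(#|N|, k) * 2 ^ k) ^ #|J| * ('C(n, k) * 2 ^ k) ^ (m - #|J|).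
Proof.
pose fam (j : 'I_m) : pred (kclause n) :=
  [pred C | is_kwidth k C & (j \in J) ==> (supp C \subset N)].
have -> : #|confined J N| = #|family fam|.
  apply: eq_card => F; rewrite inE; apply/andP/familyP => [[/forallP h1 /forall_inP h2] j|h].
    by rewrite inE h1; apply/implyP/h2.
  by split; [apply/forallP => j|apply/forall_inP => j jJ]; have := h j; rewrite inE => /andP[];
    rewrite ?jJ.
rewrite card_family foldrE big_map big_enum /= (bigID (mem J)) /=.
rewrite (eq_bigr (fun=> 'C(#|N|, k) * 2 ^ k)) => [|j jJ]; last first.
  by rewrite -card_kwidth_sub; apply: eq_card => C; rewrite !inE jJ.
rewrite [X in _ * X](eq_bigr (fun=> 'C(n, k) * 2 ^ k)) => [|j jJ]; last first.
  by rewrite -card_kwidth; apply: eq_card => C; rewrite !inE (negbTE jJ) andbT.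
rewrite !prod_nat_const; congr (_ * _ ^ _).
rewrite -[m in m - _]card_ord -(cardC (mem J)) addKn.
by apply: eq_card => j; rewrite !inE.
Qed.

(* Double counting of the incidences between [J] and its variables, each variable
   outside the boundary being counted at least twice. *)
Lemma boundary_supp F J : (forall j, is_kwidth k (F j)) ->
  2 * #|\bigcup_(j in J) supp (F j)|
    <= k * #|J| + #|boundary (fun j => kclause_lits (F j)) J|.
Proof.
move=> Fk; set N := \bigcup_(j in J) _.
pose deg v := #|[set j in J | v \in supp (F j)]|.
have -> : k * #|J| = \sum_(v in N) deg v.
  transitivity (\sum_(j in J) #|supp (F j)|).
    rewrite mulnC -sum_nat_const; apply: eq_bigr => j _; exact/esym/eqP/Fk.
  under eq_bigr do rewrite -sum1_card.
  rewrite (exchange_big_dep (mem N)) /=; last by move=> j v jJ vj; apply/bigcupP; exists j.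
  by apply: eq_bigr => v _; rewrite /deg -sum1_card; apply: eq_bigl => j; rewrite inE.
set B := boundary _ _.
have -> : #|B| = \sum_(v in N) (v \in B).
  rewrite -sum1_card [RHS]big_mkcond [LHS]big_mkcond /=; apply: eq_bigr => v _.
  case vB: (v \in B); last by case: ifP.
  suff -> : v \in N by [].
  move: vB; rewrite inE => /cards1P[j /setP/(_ j)]; rewrite !inE eqxx vars_kclause_lits => /andP[jJ vj].
  by apply/bigcupP; exists j.
rewrite -big_split /= mulnC -sum_nat_const; apply: leq_sum => v /bigcupP[j jJ vj].
have : 0 < deg v by apply/card_gt0P; exists j; rewrite inE jJ.
have -> : (v \in B) = (deg v == 1).
  by rewrite inE; congr (_ == _); apply: eq_card => j'; rewrite inE [RHS]inE vars_kclause_lits.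
by case: (deg v) => [|[|]].
Qed.

(** If [s] clauses of width [k] have fewer than [s / 2] boundary variables, [boundary_supp] leaves
    them at most [(k + 1/2) * s / 2] variables. *)
Definition spread s := (2 * k + 1) * s %/ 4.

Lemma nonexpanding_confined F r : 0 < k -> k * r <= n -> (forall j, is_kwidth k (F j)) ->
  ~ expanding (fun j => kclause_lits (F j)) r ->
  exists J N, [/\ 0 < #|J| <= r, #|N| = spread #|J| & F \in confined J N].
Proof.
move=> k0 krn Fk nexp; apply: contrapT => h; apply: nexp => J Jr.
rewrite leqNgt; apply/negP => lt_b; apply: h.
have := boundary_supp J Fk; set N := \bigcup_(j in J) _ => leN.
(* Padding the support to size exactly [spread #|J|] lets the union bound range over a single size;
   [k * r <= n] leaves the room. *)
have [|B NB Bs] := @ex_superset_card _ N (spread #|J|).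
  rewrite card_ord /spread; apply/andP; split.
    rewrite leq_divRL // mulnDl mul1n -mulnA; move: leN lt_b.
    move: #|N| #|boundary _ _| (k * #|J|) #|J|; lia.
  apply: leq_trans krn; apply: (@leq_trans (k * #|J|)); last by rewrite leq_mul2l Jr orbT.
  rewrite -(mulKn (k * #|J|) (d := 4)) // leq_div2r // mulnA leq_mul2r; apply/orP; right; lia.
exists J, B; split=> //; first by rewrite Jr andbT; apply: leq_ltn_trans lt_b.
rewrite inE; apply/andP; split; first exact/forallP.
by apply/forall_inP => j jJ; apply: subset_trans NB; apply: (bigcup_sup j).
Qed.

Lemma card_nonexpanding r : 0 < k -> k * r <= n ->
  #|[set F : kformula n m | [forall j, is_kwidth k (F j)] &&
       `[< ~ expanding (fun j => kclause_lits (F j)) r >]]|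
  <= \sum_(1 <= s < r.+1) 'C(m, s) * 'C(n, spread s) *
       (('C(spread s, k) * 2 ^ k) ^ s * ('C(n, k) * 2 ^ k) ^ (m - s)).
Proof.
move=> k0 krn; set X := [set _ | _].
pose U s := \sum_(J : {set 'I_m} | #|J| == s) \sum_(N : {set 'I_n} | #|N| == spread s) #|confined J N|.
apply: (@leq_trans (\sum_(1 <= s < r.+1) U s)); last first.
  apply: leq_sum => s _; rewrite /U.
  under eq_bigr => J /eqP Js.
    under eq_bigr => N /eqP Ns do rewrite card_confined Ns Js.
    rewrite sum_nat_cond_const; over.
  rewrite sum_nat_cond_const.
  by rewrite !card_draws !card_ord mulnA.
rewrite -sum1_card.
apply: (@leq_trans (\sum_(F in X) \sum_(1 <= s < r.+1) \sum_(J : {set 'I_m} | #|J| == s)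
   \sum_(N : {set 'I_n} | #|N| == spread s) (F \in confined J N))).
  apply: leq_sum => F; rewrite inE => /andP[/forallP Fk /asboolP nexp].
  have [J [N [/andP[J0 Jr] Ns FJN]]] := nonexpanding_confined k0 krn Fk nexp.
  rewrite (bigD1_seq #|J|) ?mem_index_iota ?J0 ?iota_uniq //=.
  by rewrite (bigD1 J) //= (bigD1 N) /= ?Ns // FJN.
rewrite exchange_big /=; apply: leq_sum => s _; rewrite exchange_big /=; apply: leq_sum => J _.
rewrite exchange_big /=; apply: leq_sum => N _.
rewrite -sum1_card big_mkcond [leqRHS]big_mkcond /=; apply: leq_sum => F _.
by case: (F \in X) => //; case: (F \in confined _ _).
Qed.

End Counting.

(** * Binomial estimates *)

Lemma leq_bin_exp2 n b : 'C(n, b) <= 2 ^ n.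
Proof.
by rewrite -[n in 'C(n, _)]card_ord -card_draws (leq_trans (max_card _)) // -cardsT -powersetT card_powerset cardsT card_ord.
Qed.

Lemma leq_exp_ffact a j n : a + j <= n -> a ^ j <= n ^_ j.
Proof.
elim: j n => [|j IH] [|n] h //; first by rewrite addnS in h.
rewrite ffactnS expnS /=; apply: leq_mul; first by lia.
by apply: IH; lia.
Qed.

Lemma leq_ffact_exp n j : n ^_ j <= n ^ j.
Proof. by elim: j => // j IH; rewrite ffactnSr expnSr leq_mul // leq_subr. Qed.

(** This is ['C(n, b) <= (4 * n / b) ^ b] without division, from
    [b ^ b <= (2 * b) ^_ b = 'C(2 * b, b) * b]! <= 4 ^ b * b[!]. *)
Lemma leq_bin_self n b : 'C(n, b) * b ^ b <= 4 ^ b * n ^ b.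
Proof.
have fact_self : b ^ b <= 4 ^ b * b`!.
  apply: leq_trans (leq_exp_ffact (n := b + b) _) _ => //.
  by rewrite -bin_ffact leq_mul2r (leq_trans (leq_bin_exp2 _ _)) ?orbT // addnn -mul2n expnM.
apply: leq_trans (leq_mul (leqnn _) fact_self) _.
by rewrite mulnCA bin_ffact leq_mul2l leq_ffact_exp orbT.
Qed.

Lemma leq_bin_ratio k b n : b <= n -> 'C(b, k) * n ^ k <= 'C(n, k) * b ^ k.
Proof.
move=> bn; rewrite -(leq_pmul2r (fact_gt0 k)) mulnAC [X in _ <= X]mulnAC !bin_ffact.
elim: k => // k IH; rewrite !ffactnSr !expnSr mulnACA [X in _ <= X]mulnACA leq_mul //.
by rewrite !mulnBl [n * b]mulnC leq_sub2l // leq_mul2l bn orbT.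
Qed.

(** Of the [k * s] factors [spread k s / n] in the union bound, [spread k s] pay for choosing the
    variables and [s] for choosing the clauses. For [k >= 3] at least [s / 4] are left over. *)
Lemma spread_split k s : 3 <= k -> 0 < s -> exists q,
  [/\ k * s = spread k s + (s + q.+1), spread k s <= k * s & s <= 4 * q.+1].
Proof.
move=> k3 s0; have := leq_trunc_div ((2 * k + 1) * s) 4.
rewrite -/(spread k s); move: (spread k s) => b h.
have [k' ek] : exists k', k = k' + 3 by exists (k - 3); lia.
have eu : (2 * k + 1) * s = 2 * (k' * s) + 7 * s by rewrite ek; ring.
have ev : k * s = k' * s + 3 * s by rewrite ek; ring.
move: h; rewrite eu ev; move: (k' * s) => u h.
exists (u + 2 * s - b).-1; split; lia.
Qed.

Local Open Scope ring_scope.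

(** * The union bound over non-expanding sets of clauses *)

Section UnionBound.
Variables (R : realType) (k : nat) (c : R).
Hypotheses (k3 : (3 <= k)%N) (c1 : 1 <= c).

(** [A] is the loss per clause of a set of size [s]. As [s <= 4 * q], the loss [A ^+ s] is absorbed
    by the [q] spare factors [k * s / n], turning each into [M * s / n]. *)
Let A : R := 4 ^+ k.+1 * c * k%:R.
Definition union_const : R := A ^+ 4 * k%:R.
Let M := union_const.

Let A1 : 1 <= A.
Proof.
rewrite /A; apply: mulr_ege1; last by rewrite ler1n; lia.
by apply: mulr_ege1 => //; apply: exprn_ege1; rewrite ler1n.
Qed.

Let M0 : 0 <= M.
Proof. by rewrite mulr_ge0 ?ler0n // exprn_ge0 // (le_trans ler01 A1). Qed.

Lemma union_const_ge : k%:R <= M.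
Proof. by rewrite /M /union_const ler_peMl ?ler0n // exprn_ege1. Qed.

Variables (n m : nat).
Hypotheses (n0 : (0 < n)%N) (kn : (k <= n)%N) (mc : m%:R <= c * n%:R).

Lemma union_term s : (0 < s)%N -> (k * s <= n)%N -> M * s%:R / n%:R <= 256^-1 ->
  'C(m, s)%:R * 'C(n, spread k s)%:R * ((spread k s)%:R / n%:R) ^+ (k * s)
    <= 256 * M / n%:R * 2^-1 ^+ s :> R.
Proof.
move=> s0 ksn Ms; set b := spread k s.
have [q' []] := spread_split k3 s0; set q := q'.+1; rewrite -/b => eks bks q4.
have nR : 0 < n%:R :> R by rewrite ltr0n.
have sR : 0 < s%:R :> R by rewrite ltr0n.
have c0 : 0 <= c by apply: le_trans c1.
have h1 : 'C(m, s)%:R <= (4 * c * n%:R / s%:R) ^+ s :> R.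
  rewrite expr_div_n ler_pdivlMr ?exprn_gt0 // -natrX -natrM.
  apply: (@le_trans _ _ (4 ^ s * m ^ s)%:R); first by rewrite ler_nat leq_bin_self.
  rewrite natrM !natrX -exprMn -mulrA; apply: lerXn2r; rewrite ?nnegrE ?mulr_ge0 ?ler0n //.
  by rewrite ler_wpM2l.
have h2 : 'C(n, b)%:R * (b%:R / n%:R) ^+ b <= (4 ^+ k) ^+ s :> R.
  rewrite expr_div_n mulrA ler_pdivrMr ?exprn_gt0 // -exprM -!natrX -!natrM ler_nat.
  apply: leq_trans (leq_bin_self _ _) _; by rewrite leq_mul2r leq_exp2l ?bks ?orbT.
have u0 : 0 <= k%:R * s%:R / n%:R :> R by rewrite divr_ge0 ?mulr_ge0.
have bu : b%:R / n%:R <= k%:R * s%:R / n%:R :> R.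
  by rewrite ler_pM2r ?invr_gt0 // -natrM ler_nat.
have h3 : (b%:R / n%:R) ^+ (s + q) <= (k%:R * s%:R / n%:R) ^+ (s + q) :> R.
  by apply: lerXn2r => //; rewrite nnegrE ?divr_ge0.
rewrite eks exprD mulrA -[X in X * _]mulrA.
apply: (@le_trans _ _ ((4 * c * n%:R / s%:R) ^+ s * (4 ^+ k) ^+ s * (k%:R * s%:R / n%:R) ^+ (s + q))).
  apply: ler_pM => //; rewrite ?mulr_ge0 ?exprn_ge0 ?divr_ge0 //.
  by apply: ler_pM => //; rewrite ?mulr_ge0 ?exprn_ge0 ?divr_ge0.
rewrite exprD mulrA -!exprMn.
have -> : 4 * c * n%:R / s%:R * 4 ^+ k * (k%:R * s%:R / n%:R) = A.
  by rewrite /A exprS; field; rewrite !lt0r_neq0.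
apply: (@le_trans _ _ ((A ^+ 4) ^+ q * (k%:R * s%:R / n%:R) ^+ q)).
  by rewrite ler_wpM2r ?exprn_ge0 // -exprM; apply: ler_weXn2l.
rewrite -exprMn; have -> : A ^+ 4 * (k%:R * s%:R / n%:R) = M * s%:R / n%:R.
  by rewrite /M /union_const !mulrA.
(* One spare factor is kept for the decay in [n]; the others, each at most [1 / 256], give the decay
   in [s]. *)
rewrite exprS.
have x0 : 0 <= M * s%:R / n%:R.
  by apply: divr_ge0 => //; apply: mulr_ge0.
apply: (@le_trans _ _ (M * s%:R / n%:R * 256^-1 ^+ q')).
  by apply: ler_wpM2l => //; apply: lerXn2r => //; rewrite nnegrE ?invr_ge0.
have -> : M * s%:R / n%:R * 256^-1 ^+ q' = M / n%:R * (s%:R * 256^-1 ^+ q') by ring.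
have -> : 256 * M / n%:R * 2^-1 ^+ s = M / n%:R * (256 * 2^-1 ^+ s) by ring.
apply: ler_wpM2l; first by rewrite divr_ge0.
rewrite !exprVn ler_pdivrMr ?exprn_gt0 // mulrAC ler_pdivlMr ?exprn_gt0 //.
rewrite -exprS -!natrX -natrM ler_nat.
apply: (@leq_trans (2 ^ s * 2 ^ s)); first by rewrite leq_mul2r ltnW ?orbT // ltn_expl.
by rewrite -expnD -(expnM 2 8) leq_exp2l //; move: q4; rewrite /q; clear; lia.
Qed.

Lemma half_sum r : \sum_(1 <= s < r.+1) (2^-1 : R) ^+ s <= 1.
Proof.
suff -> : \sum_(1 <= s < r.+1) (2^-1 : R) ^+ s = 1 - 2^-1 ^+ r.
  by rewrite lerBlDr lerDl exprn_ge0 ?invr_ge0.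
elim: r => [|r IH]; first by rewrite big_geq // expr0 subrr.
by rewrite big_nat_recr //= IH !exprS; field.
Qed.

Lemma prob_expanding r (P : kformula n m -> Prop) :
  (k * r <= n)%N -> M * r%:R / n%:R <= 256^-1 ->
  (forall F : kformula n m, (forall j, is_kwidth k (F j)) ->
     expanding (fun j => kclause_lits (F j)) r -> P F) ->
  1 - 256 * M / n%:R <= prob_kcnf R k n m P.
Proof.
move=> krn Mr expP; rewrite /prob_kcnf card_kwidth; set a := ('C(n, k) * 2 ^ k)%N.
have a0 : (0 < a)%N by rewrite muln_gt0 bin_gt0 kn expn_gt0.
have am0 : 0 < (a ^ m)%N%:R :> R by rewrite ltr0n expn_gt0 a0.
have nR : 0 < n%:R :> R by rewrite ltr0n.
have k0 : (0 < k)%N by lia.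
rewrite ler_pdivlMr // mulrBl mul1r lerBlDr.
set X := [set _ | _]; pose Y := [set F : kformula n m | [forall j, is_kwidth k (F j)] &&
       `[< ~ expanding (fun j => kclause_lits (F j)) r >]].
have leXY : (a ^ m <= #|X| + #|Y|)%N.
  (* With an empty set of constrained clauses, [confined] is the whole probability space. *)
  have := card_confined k (set0 : {set 'I_m}) (setT : {set 'I_n}).
  rewrite cards0 expn0 mul1n subn0 -/a => <-; apply: leq_trans (leq_card_setU _ _).
  apply/subset_leq_card/subsetP => F; rewrite !inE => /andP[kF _]; rewrite kF /=.
  have [e|ne] := pselect (expanding (fun j => kclause_lits (F j)) r).
    by apply/orP; left; apply/asboolP/expP => //; apply/forallP.
  by apply/orP; right; apply/asboolP.
apply: (@le_trans _ _ (#|X| + #|Y|)%:R); first by rewrite ler_nat.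
rewrite natrD lerD2l.
apply: le_trans (_ : (\sum_(1 <= s < r.+1) 'C(m, s) * 'C(n, spread k s) *
       (('C(spread k s, k) * 2 ^ k) ^ s * a ^ (m - s)))%N%:R <= _).
  by rewrite ler_nat; apply: card_nonexpanding.
rewrite natr_sum -ler_pdivrMr // mulr_suml.
apply: (@le_trans _ _ (\sum_(1 <= s < r.+1) (256 * M / n%:R * 2^-1 ^+ s))); last first.
  rewrite -mulr_sumr -[leRHS]mulr1; apply: ler_wpM2l (half_sum r).
  by apply: divr_ge0 => //; apply: mulr_ge0.
rewrite big_nat_cond [leRHS]big_nat_cond; apply: ler_sum => s /andP[/andP[s0 sr] _].
have ksn : (k * s <= n)%N by apply: leq_trans krn; rewrite leq_mul2l -ltnS sr orbT.
apply: le_trans (union_term s0 ksn _); last first.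
  apply: le_trans Mr; rewrite ler_pM2r ?invr_gt0 //; apply: ler_wpM2l => //.
  by rewrite ler_nat -ltnS.
(* For [s > m] the subtraction [m - s] is truncated, but the binomial vanishes. *)
have [ms|sm] := ltnP m s.
  by rewrite bin_small // !mul0n !mul0r.
rewrite natrM -!mulrA natrM -mulrA; apply: ler_wpM2l => //; apply: ler_wpM2l => //.
rewrite ler_pdivrMr // -[in leRHS](subnKC sm) expnD !natrM mulrA; apply: ler_wpM2r => //.
rewrite exprM !natrX -exprMn; apply: lerXn2r; rewrite ?nnegrE ?mulr_ge0 ?exprn_ge0 ?divr_ge0 //.
rewrite expr_div_n mulrAC ler_pdivlMr ?exprn_gt0 // -!natrX -!natrM ler_nat.
rewrite /a mulnAC mulnA leq_mul2r [X in (_ <= X)%N]mulnC; apply/orP; right.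
apply: leq_bin_ratio; apply: leq_trans ksn.
by have [q []] := spread_split k3 s0.
Qed.

End UnionBound.

(** * Constants and conclusion *)

Lemma random_refutation_le (V : eqType) (R : realType) (H : clause V -> Prop)
    (e e' : R) (w w' : nat) :
  e <= e' -> (w <= w')%N -> random_refutation H e w -> random_refutation H e' w'.
Proof.
move=> le_e le_w [D [D0 D1 D2 D3]]; exists D; split=> // [d dD d0|x].
  by have [r1 r2 r3] := D2 d dD d0; split=> //; apply: leq_trans le_w.
by apply: le_trans (D3 x); rewrite lerD2l lerN2.
Qed.

Lemma powR_neg_log (R : realType) (z : R) n :
  0 < z -> (2 : R) `^ (- (- ln z / ln 2 * n%:R)) = z ^+ n.
Proof.
move=> z0; have l2 : ln 2 != 0 :> R by rewrite gt_eqF // ln_gt0 // ltr1n.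
rewrite /powR ifF; last by rewrite pnatr_eq0.
rewrite (_ : _ * ln 2 = ln z *+ n); last by rewrite -[ln z *+ n]mulr_natr; field.
by rewrite -[ln z *+ n]mulr_natl expRM_natl lnK.
Qed.

Lemma bernoulli_le (R : realType) (y : R) j : 0 <= y <= 1 -> 1 - j%:R * y <= (1 - y) ^+ j.
Proof.
move=> /andP[y0 y1]; elim: j => [|j IH]; first by rewrite mul0r subr0 expr0.
rewrite exprS; have h : 0 <= 1 - y by lra.
apply: le_trans (ler_wpM2l h IH).
have : 0 <= j%:R * y * y by rewrite !mulr_ge0.
by rewrite -natr1; nra.
Qed.

Lemma query_bound_le n m L c0 : (0 < n)%N -> (m <= c0 * n)%N -> (L <= 2 ^ n)%N ->
  (query_bound n m L <= (12 + 2 * c0) * n ^ 1)%N.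
Proof.
move=> n0 mc L2; have n2 := ltnW (ltn_expl n (ltnSn 1)).
have vn : (var_width n <= n)%N by apply: up_log_min.
have pw : (ptr_width m L <= c0.+1 + n)%N.
  (* [m + L <= c0 * n + 2 ^ n <= 2 ^ c0.+1 * 2 ^ n], so pointers have linearly many bits. *)
  apply: up_log_min => //; rewrite expnD.
  have := ltn_expl c0.+1 (ltnSn 1); nia.
rewrite /query_bound expn1; nia.
Qed.

(* With [t = n / Q], a wide node survives a random restriction with probability at most
   [(1 - 1 / (4 Q)) ^ t <= (1 - y) ^ n] for [y = 1 / (8 Q ^ 2)], which beats the union
   bound over [(1 + y) ^ n] nodes. *)
Lemma survival_bound (R : realType) (Q n L : nat) : (0 < Q <= n)%N ->
  let y : R := (8 * Q%:R ^+ 2)^-1 in let t := (n %/ Q)%N in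
  L%:R <= (1 + y) ^+ n ->
  L%:R * ((2 * n - t)%:R / (2 * n)%:R) ^+ t <= (1 - y ^+ 2) ^+ n.
Proof.
move=> /andP[Q0 Qn] y t Ly.
have QR : 1 <= Q%:R :> R by rewrite ler1n.
have Q2 : 0 < 8 * Q%:R ^+ 2 :> R by rewrite mulr_gt0 // exprn_gt0 // (lt_le_trans ltr01).
have y0 : 0 <= y by rewrite invr_ge0 ltW.
have y1 : y <= 1 by rewrite invf_le1 // mulr_ege1 // ?exprn_ege1 // ler1n.
have n0 : (0 < n)%N by apply: leq_trans Qn.
have nt : (n <= 2 * Q * t)%N.
  have := ltn_ceil n Q0; have : (0 < t)%N by rewrite divn_gt0.
  rewrite -/t; nia.
have tn : (t <= n)%N by apply: leq_div.
(* Since [t >= n / (2 * Q)], the ratio is at most [1 - 1 / (4 * Q) = 1 - 2 * Q * y], and Bernoulli's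
   inequality applies. *)
have h : (2 * n - t)%:R / (2 * n)%:R <= (1 - y) ^+ (2 * Q) :> R.
  apply: le_trans (bernoulli_le _ _); last by rewrite y0.
  rewrite ler_pdivrMr ?ltr0n ?muln_gt0 // natrB; last by lia.
  rewrite mulrBl mul1r lerD2l lerN2.
  have -> : (2 * Q)%:R * y = (4 * Q%:R)^-1.
    by rewrite natrM /y; field; rewrite lt0r_neq0 // (lt_le_trans ltr01).
  rewrite mulrC ler_pdivrMr ?mulr_gt0 ?ltr0n // -!natrM ler_nat.
  by move: nt; nia.
have p0 : 0 <= 1 - y by lra.
apply: (@le_trans _ _ ((1 + y) ^+ n * (1 - y) ^+ n)); last first.
  by rewrite -exprMn; have -> : (1 + y) * (1 - y) = 1 - y ^+ 2 by ring.
apply: ler_pM => //; first by rewrite exprn_ge0 // divr_ge0.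
apply: (@le_trans _ _ (((1 - y) ^+ (2 * Q)) ^+ t)).
  by apply: lerXn2r => //; rewrite nnegrE ?divr_ge0 ?exprn_ge0.
by rewrite -exprM; apply: ler_wiXn2l => //; lra.
Qed.

Theorem theorem6p3 (R : realType) :
  forall k : nat, (3 <= k)%N ->
  forall c : R, (7 / 10) * 2 ^+ k <= c ->
  exists eps : R, 0 < eps /\
  exists (Cw d : nat) (delta : R), 0 < delta /\
  forall eta : R, 0 < eta ->
  exists N : nat, forall n : nat, (N <= n)%N ->
    let m := Num.truncn (c * n%:R) in
    let L := Num.truncn ((1 + eps) ^+ n) in
    1 - eta <=
      prob_kcnf R k n m
        (fun F => random_refutation (sLB L F)
                    ((2 : R) `^ (- (delta * n%:R))) (Cw * n ^ d)).
Proof.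
move=> k k3 c hc.
have c1 : 1 <= c.
  apply: le_trans hc; have : 2 ^+ 3 <= 2 ^+ k :> R by apply: ler_weXn2l => //; rewrite ler1n.
  by rewrite !exprS expr0; lra.
pose M := union_const k c; have kM : k%:R <= M by apply: union_const_ge.
have M0 : 0 <= M by apply: le_trans kM.
(* [2048 = 8 * 256]: expansion is needed up to [8 * t <= 8 * n / Q], and the union bound requires
   [M * r / n <= 1 / 256]. *)
pose Q := (Num.truncn (2048 * M)).+1.
have QM : 2048 * M <= Q%:R by apply/ltW; rewrite /Q truncnS_gt.
have Q8k : (8 * k <= Q)%N by rewrite -(ler_nat R) natrM; lra.
have Q0 : (0 < Q)%N by [].
have QR : 1 <= Q%:R :> R by rewrite ler1n.
pose y : R := (8 * Q%:R ^+ 2)^-1.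
have Q2 : 8 <= 8 * Q%:R ^+ 2 :> R by rewrite ler_peMr // exprn_ege1.
have y0 : 0 < y by rewrite invr_gt0; lra.
have y1 : y <= 8^-1 by rewrite lef_pV2 ?posrE //; lra.
have [ylt1 yle2 yge1] : [/\ y < 1, 1 + y <= 2 & 1 <= 1 + y] by move: y0 y1; clear; split; lra.
have z0 : 0 < 1 - y ^+ 2 by rewrite subr_gt0 exprn_ilt1 // ltW.
exists y; split=> //; exists (12 + 2 * (Num.truncn c).+1)%N, 1%N, (- ln (1 - y ^+ 2) / ln 2); split.
  rewrite divr_gt0 ?ln_gt0 ?ltr1n // oppr_gt0 ln_lt0 // z0 /=.
  by rewrite ltrBlDr ltrDl exprn_gt0.
(* The first summand ensures [k <= t] for [t = n / Q], the second [256 * M / n <= eta]. *)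
move=> eta eta0; exists (Q * k + (Num.truncn (256 * M / eta)).+1)%N => n Nn; cbv zeta.
set m := Num.truncn (c * n%:R); set L := Num.truncn ((1 + y) ^+ n).
have Qkn : (Q * k <= n)%N := leq_trans (leq_addr _ _) Nn.
have kn : (k <= n)%N by apply: leq_trans Qkn; apply: leq_pmull.
have n0 : (0 < n)%N := leq_trans (ltnW (ltnW k3)) kn.
have Qn : (Q <= n)%N by apply: leq_trans Qkn; apply/leq_pmulr/ltnW/ltnW.
have nR : 0 < n%:R :> R by rewrite ltr0n.
have mc : m%:R <= c * n%:R by rewrite truncn_le mulr_ge0 // (le_trans ler01).
set t := (n %/ Q)%N.
have Qt : (t * Q <= n)%N := leq_trunc_div n Q.
have kt : (k <= t)%N by rewrite leq_divRL // mulnC.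
have Ly : L%:R <= (1 + y) ^+ n by rewrite truncn_le exprn_ge0 // (le_trans ler01).
have L0 : (0 < L)%N by rewrite truncn_gt0 exprn_ege1.
have L2 : (L <= 2 ^ n)%N.
  rewrite -(ler_nat R); apply: le_trans Ly _; rewrite natrX.
  by apply: lerXn2r; rewrite ?nnegrE // (le_trans ler01).
have mn : (m <= (Num.truncn c).+1 * n)%N.
  rewrite -(ler_nat R) natrM; apply: le_trans mc _; rewrite ler_pM2r //.
  by apply/ltW; rewrite truncnS_gt.
apply: (@le_trans _ _ (1 - 256 * M / n%:R)).
  rewrite lerD2l lerN2 ler_pdivrMr // [leRHS]mulrC -ler_pdivrMr //.
  apply: ltW; apply: lt_le_trans (truncnS_gt _) _.
  by rewrite ler_nat; apply: leq_trans (leq_addl _ _) Nn.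
(* With [d = t], which bounds the axiom width [k], the initial width is [t + t], so expansion is
   required up to [4 * (t + t) = 8 * t]. *)
apply: (@prob_expanding _ k c k3 c1 n m n0 kn mc (8 * t)%N) => //.
- by apply: leq_trans Qt; rewrite [leqRHS]mulnC mulnA leq_mul2r mulnC Q8k orbT.
- rewrite ler_pdivrMr // natrM.
  have : t%:R * Q%:R <= n%:R :> R by rewrite -natrM ler_nat.
  have : 0 <= t%:R :> R by [].
  rewrite -/M; move: QM M0; clear; nra.
move=> F Fk expF; rewrite powR_neg_log //.
apply: (random_refutation_le (survival_bound _ Ly) (query_bound_le n0 mn L2)); first by rewrite Q0.
apply: sLB_random_refutation => //.
  by move=> j; rewrite card_kclause_lits; have /eqP -> := Fk j.
by apply: expanding_width; rewrite addnn -mul2n ?mulnA // muln_gt0 (leq_trans _ kt) // ltnW // ltnW.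
Qed.
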